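(* For $k\ge 1$, let $\mathfrak{g}_k=\mathfrak{p}^A\frac{k|1}{k+1}$. Then $\mathfrak{g}_k$ is Frobenius, the spectrum of $\mathfrak{g}_k$ is equal to $$\bigcup_{i=1}^k\left\{(-k+i)^i,(k-i+1)^i\right\},$$ and the extended spectrum of $\mathfrak{g}_k$ is equal to $$\{0^k\}\cup\bigcup_{i=0}^{k-1}\left\{(-k+i)^{i+1},(k-i)^{i+1}\right\}.$$
   Context: Type-A seaweeds: for compositions $\underline a=(a_1,\dots,a_m)$ and $\underline b=(b_1,\dots,b_t)$ of $n$, let $e_1,\dots,e_n$ be a basis of $V=\mathbb{C}^n$, $V_i=\mathrm{span}\{e_1,\dots,e_{a_1+\dots+a_i}\}$ and $W_j=\mathrm{span}\{e_{b_1+\dots+b_j+1},\dots,e_n\}$. The type-A seaweed $\mathfrak{p}^A\frac{a_1|\cdots|a_m}{b_1|\cdots|b_t}$ is the subalgebra of $\mathfrak{sl}(n)$ of matrices preserving both flags $0\subset V_1\subset\dots\subset V_m=V$ and $V=W_0\supset W_1\supset\dots\supset W_t=0$. A Lie algebra $\mathfrak{g}$ is Frobenius if there is $F\in\mathfrak{g}^*$ with $(x,y)\mapsto F([x,y])$ nondegenerate; then there is a unique $\widehat F\in\mathfrak{g}$ with $F([\widehat F,x])=F(x)$ for all $x$, and the spectrum of $\mathfrak{g}$ is the multiset of eigenvalues of $\mathrm{ad}\,\widehat F$ on $\mathfrak{g}$ (independent of the choice of Frobenius $F$). Meander: $M(\mathfrak{g})$ has vertices $v_1,\dots,v_n$ in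 a row; the vertices are grouped into consecutive blocks of sizes $a_1,\dots,a_m$, and within each block the first and last vertex, the second and second-to-last, etc., are joined by top edges (when distinct); similarly blocks of sizes $b_1,\dots,b_t$ give bottom edges. Top edges are oriented right to left and bottom edges left to right. For a Frobenius type-A seaweed $M(\mathfrak{g})$ is a single path, so for each $i,j$ there is a unique path $P_{i,j}$ from $v_i$ to $v_j$; its weight $w(P_{i,j})$ is the number of edges traversed along their orientation minus the number traversed against it. The extended spectrum is the multiset $\{w(P_{i,j}):1\le i,j\le n\}$ with a single copy of $0$ removed. Notation: $\{x^k\}$ denotes $x$ with multiplicity $k$, and $\cup$ denotes multiset union (multiplicities add). *)

(* Defs.v *)
From HB Require Import structures.
From mathcomp Require Import all_boot all_order all_algebra.
From mathcomp Require Import finmap multiset.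
From mathcomp Require Import complex reals.

Set Implicit Arguments.
Unset Strict Implicit.
Unset Printing Implicit Defensive.

Import GRing.Theory.
Local Open Scope ring_scope.
Local Open Scope mset_scope.

HB.mixin Record isLieAlgebra (K : fieldType) g of Vector K g := {
  lie : g -> g -> g;
  lie_linearl : forall y, linear (lie^~ y);
  lie_linearr : forall x, linear (lie x);
  liexx : forall x, lie x x = 0;
  lie_jacobi : forall x y z,
    lie x (lie y z) + lie y (lie z x) + lie z (lie x y) = 0
}.

#[short(type="lieAlgType")]
HB.structure Definition LieAlgebra (K : fieldType) :=
  { g of isLieAlgebra K g & Vector K g }.

Section Frobenius.
Variables (K : fieldType) (g : lieAlgType K).

HB.instance Definition _ (x : g) :=
  GRing.isLinear.Build K g g _ (lie x) (lie_linearr x).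

Definition ad (x : g) : 'End(g) := linfun (lie x).

Lemma adE x y : ad x y = lie x y.
Proof. exact: lfunE. Qed.

(* The form (x, y) |-> F [x, y] is alternating, so its left radical is also
   its right radical. *)
Definition frobenius_functional (F : 'Hom(g, K^o)) : Prop :=
  forall x : g, (forall y : g, F (lie x y) = 0) -> x = 0.

Definition frobenius : Prop :=
  exists F : 'Hom(g, K^o), frobenius_functional F.

Definition principal_element (F : 'Hom(g, K^o)) (Fhat : g) : Prop :=
  forall x : g, F (lie Fhat x) = F x.

End Frobenius.

Section Spectrum.
Variable K : closedFieldType.

(* Eigenvalues are counted with algebraic multiplicity. *)
Definition eigenvalues (V : vectType K) (f : 'End(V)) : {mset K} :=
  seq_mset (sval (closed_field_poly_normal
    (char_poly (passmx.mxof (vbasis {:V}) (vbasis {:V}) f)))).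

Lemma eigenvaluesE (V : vectType K) (f : 'End(V)) (c : K) :
  eigenvalues f c = mup c (char_poly (passmx.mxof (vbasis {:V}) (vbasis {:V}) f)).
Proof.
rewrite /eigenvalues; case: closed_field_poly_normal => s /= ->.
by rewrite (monicP (char_poly_monic _)) scale1r mset_seqE mu_prod_XsubC.
Qed.

(* The spectrum does not depend on the Frobenius functional, so all of them are
   required to give the same multiset. *)
Definition is_spectrum (g : lieAlgType K) (S : {mset K}) : Prop :=
  frobenius g /\
  forall F : 'Hom(g, K^o), frobenius_functional F ->
  exists Fhat : g,
    unique (principal_element F) Fhat /\ eigenvalues (ad Fhat) = S.

End Spectrum.

Section Seaweed.
Variables (K : fieldType) (n : nat).

Definition sl_space : {vspace 'M[K]_n} :=
  lker (linfun (mxtrace : 'M[K]_n -> K^o)).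

Definition stabilizer (U : {vspace 'cV[K]_n}) : {vspace 'M[K]_n} :=
  (\bigcap_(u <- vbasis U) (linfun (mulmxr u) @^-1: U))%VS.

(* Matrices act on column vectors and e_(j+1) is [delta_mx j 0]; [a] and [b] are
   meant to be compositions of [n]. *)
Definition flagV (a : seq nat) (i : nat) : {vspace 'cV[K]_n} :=
  span [seq delta_mx j 0 | j : 'I_n <- enum 'I_n & (j < sumn (take i a))%N].

Definition flagW (b : seq nat) (i : nat) : {vspace 'cV[K]_n} :=
  span [seq delta_mx j 0 | j : 'I_n <- enum 'I_n & (sumn (take i b) <= j)%N].

Definition seaweed_space (a b : seq nat) : {vspace 'M[K]_n} :=
  (sl_space :&: (\bigcap_(i < (size a).+1) stabilizer (flagV a i))
            :&: (\bigcap_(i < (size b).+1) stabilizer (flagW b i)))%VS.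

Lemma stabilizerP (U : {vspace 'cV[K]_n}) (x : 'M[K]_n) :
  reflect (forall u, u \in U -> x *m u \in U) (x \in stabilizer U).
Proof.
have capE (s : seq 'cV[K]_n) :
    (x \in (\bigcap_(u <- s) (linfun (mulmxr u) @^-1: U))%VS) =
    all (fun u => x *m u \in U) s.
  elim: s => [|u s IHs]; first by rewrite big_nil memvf.
  by rewrite big_cons memv_cap IHs -memv_preim lfunE.
rewrite /stabilizer capE; apply: (iffP allP) => [xU u uU|xU u /vbasis_mem/xU//].
rewrite (coord_vbasis uU) mulmx_sumr memv_suml// => i _.
by rewrite -scalemxAr memvZ// xU// mem_nth// size_tuple.
Qed.

Lemma seaweed_spaceP (a b : seq nat) (x : 'M[K]_n) :
  reflect
    [/\ \tr x = 0,
        forall i, (i <= size a)%N ->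
          forall u, u \in flagV a i -> x *m u \in flagV a i
      & forall i, (i <= size b)%N ->
          forall u, u \in flagW b i -> x *m u \in flagW b i]
    (x \in seaweed_space a b).
Proof.
have capE m (U : nat -> {vspace 'cV[K]_n}) :
    reflect (forall i, (i <= m)%N -> forall u, u \in U i -> x *m u \in U i)
            (x \in (\bigcap_(i < m.+1) stabilizer (U i))%VS).
  rewrite memvE; apply: (iffP subv_bigcapP) => [xU i im|xU i _].
    by apply/stabilizerP; have := xU (Ordinal (im : (i < m.+1)%N)) isT; rewrite -memvE.
  by rewrite -memvE; apply/stabilizerP/xU; rewrite -ltnS.
rewrite /seaweed_space !memv_cap memv_ker lfunE /= -andbA.
by apply: (iffP and3P) => -[/eqP ? /capE ? /capE ?]; split=> //; apply/eqP || apply/capE.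
Qed.

Lemma seaweed_space_lie (a b : seq nat) (x y : 'M[K]_n) :
  x \in seaweed_space a b -> y \in seaweed_space a b ->
  x *m y - y *m x \in seaweed_space a b.
Proof.
move=> /seaweed_spaceP[_ xV xW] /seaweed_spaceP[_ yV yW].
apply/seaweed_spaceP; split=> [|i ia u uU|i ib u uU].
- by rewrite raddfB /= mxtrace_mulC subrr.
- by rewrite mulmxBl -!mulmxA memvB// ?(xV i ia, yV i ia).
- by rewrite mulmxBl -!mulmxA memvB// ?(xW i ib, yW i ib).
Qed.

Definition seaweed (a b : seq nat) : Type := subvs_of (seaweed_space a b).

Section LieStructure.
Variables a b : seq nat.
Local Notation g := (seaweed a b).

HB.instance Definition _ := Vector.on g.

Definition seaweed_lie (x y : g) : g :=
  Subvs (seaweed_space_lie (subvsP x) (subvsP y)).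

Lemma seaweed_lie_linearl y : linear (seaweed_lie^~ y).
Proof.
move=> c x z; apply/val_inj.
rewrite /= mulmxDl mulmxDr -scalemxAl -scalemxAr scalerBr opprD.
by rewrite addrACA.
Qed.

Lemma seaweed_lie_linearr x : linear (seaweed_lie x).
Proof.
move=> c y z; apply/val_inj.
rewrite /= mulmxDl mulmxDr -scalemxAl -scalemxAr scalerBr opprD.
by rewrite addrACA.
Qed.

Lemma seaweed_liexx x : seaweed_lie x x = 0.
Proof. by apply/val_inj; rewrite /= subrr. Qed.

Lemma seaweed_lie_jacobi x y z :
  seaweed_lie x (seaweed_lie y z) + seaweed_lie y (seaweed_lie z x)
  + seaweed_lie z (seaweed_lie x y) = 0.
Proof.
have regroup (s t u v : 'M[K]_n) : s - t - (u - v) = (s + v) - (t + u).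
  by rewrite opprB opprD addrACA [- t + _]addrC addrACA addrC -addrA.
apply/val_inj; rewrite /= !mulmxBl !mulmxBr !mulmxA !regroup.
rewrite [vsval y *m vsval z *m _ + _]addrC [vsval y *m vsval x *m _ + _]addrC.
rewrite [X in _ + (_ - X) = _]addrC addrA [_ - _ + (_ - _)]addrA.
by rewrite !subrK subrr.
Qed.

HB.instance Definition _ := isLieAlgebra.Build K g
  seaweed_lie_linearl seaweed_lie_linearr seaweed_liexx seaweed_lie_jacobi.

End LieStructure.
End Seaweed.

Section Meander.
Variables (n : nat) (a b : seq nat).

(* With vertices numbered from 0, the block of [c] that starts after [s]
   vertices and has size [l] consists of s, ..., s + l - 1, and its mirror
   pairs (u, v) satisfy u + v = 2 s + l - 1. *)
Definition block_edge (c : seq nat) (u v : 'I_n) : bool :=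
  (u != v) &&
  has (fun m => let s := sumn (take m c) in let l := nth 0%N c m in
         [&& (s <= u)%N, (u < s + l)%N & (u + v).+1 == (s + (s + l))%N])
      (iota 0 (size c)).

Definition meander_arc (u v : 'I_n) : bool :=
  (block_edge a u v && (v < u)%N) || (block_edge b u v && (u < v)%N).

Definition meander_edge (u v : 'I_n) : bool :=
  meander_arc u v || meander_arc v u.

Definition meander_path (i j : 'I_n) (p : seq 'I_n) : Prop :=
  [/\ path meander_edge i p, uniq (i :: p) & last i p = j].

Definition path_weight (i : 'I_n) (p : seq 'I_n) : int :=
  \sum_(w <- pairmap (fun u v => (meander_arc u v)%:Z - (meander_arc v u)%:Z) i p)
    w.

(* For a Frobenius seaweed the meander is a single path; in particular no two
   vertices are joined by both a top and a bottom edge, so a path is determined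
   by its vertices. *)
Definition is_extended_spectrum (S : {mset int}) : Prop :=
  exists P : 'I_n -> 'I_n -> seq 'I_n,
    (forall i j, unique (meander_path i j) (P i j)) /\
    S = seq_mset [seq path_weight i (P i j) | i <- enum 'I_n, j <- enum 'I_n]
        `\` [mset 0].

End Meander.

(* Main.v *)
Require Import Defs.
From HB Require Import structures.
From mathcomp Require Import all_boot all_order all_algebra.
From mathcomp Require Import finmap multiset.
From mathcomp Require Import complex reals.
From mathcomp Require Import spectral ring zify.

(* Let n = k + 1, let J be the n x k inclusion of the first k coordinates and e
   the last basis vector.  An element of the seaweed is J N + t with N an
   arbitrary k x n matrix and t a scalar fixed by the trace, and in terms of N
   the bracket is [N, N'] = (N J) N' - N' (J N).  A functional is
   N |-> tr (B N) for an n x k matrix B; put phi = e^T B and M = J^T B.  It is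
   Frobenius iff the rows phi, phi M, ..., phi M^(k-1) are independent: if they
   are not, a right eigenvector w of M killed by all of them and a left
   eigenvector r with the same eigenvalue give the radical element w r.
   The principal element N satisfies, with A = N J and v = N e,
   phi A = phi and M A - A M = M + v phi, so phi M^i A is (i + 1) phi M^i plus
   lower terms and A has eigenvalues 1, ..., k.  Then J N has eigenvalues
   0, ..., k and the ad-eigenvalues are the i - j with 1 <= i <= k and
   0 <= j <= k.
   The meander is the path v_(k+1), v_1, v_k, v_2, v_(k-1), ... with all edges
   oriented towards its starting point, so weights are differences of
   positions. *)

Import GRing.Theory Num.Theory passmx.
Local Open Scope ring_scope.
Local Open Scope mset_scope.
Local Open Scope complex_scope.

(** * Multisets of differences *)

Lemma big_msetDE (T : choiceType) (I : Type) (r : seq I) (F : I -> {mset T}) c :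
  (\big[msetD/mset0]_(i <- r) F i) c = (\sum_(i <- r) F i c)%N.
Proof.
elim: r => [|i r IHr]; first by rewrite !big_nil mset0E.
by rewrite !big_cons msetE2 IHr.
Qed.

Lemma msetn_mul (T : choiceType) m (x c : T) : msetn m x c = (m * (x == c))%N.
Proof. by rewrite msetnE eq_sym; case: eqP; rewrite (muln1, muln0). Qed.

Lemma count_allpairs_ord (T : eqType) m n (f : 'I_m -> 'I_n -> T) c :
  count_mem c [seq f i j | i <- enum 'I_m, j <- enum 'I_n] =
  (\sum_(i < m) \sum_(j < n) (f i j == c))%N.
Proof.
rewrite count_flatten sumnE !big_map -enumT big_enum; apply: eq_bigr => i _ /=.
by rewrite count_map -sum1_count big_mkcond big_enum; apply: eq_bigr => j _ /=; case: eqP.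
Qed.

(** The induction step of both counts below: passing from k to k + 1 adds one copy of each of F 0,
    ..., F k. *)
Lemma sum_subn_mul (F : nat -> nat) k :
  (\sum_(m < k.+1) (k.+1 - m) * F m =
   \sum_(m < k) (k - m) * F m + \sum_(m < k.+1) F m)%N.
Proof.
rewrite !big_ord_recr /= subSnn mul1n addnA; congr addn; rewrite -big_split /=.
by apply: eq_bigr => i _; rewrite subSn 1?ltnW // mulSn addnC.
Qed.

Section DifferenceCount.

Variables (A : zmodType) (x c : A).

Lemma diff_mulrn_low k :
  (\sum_(i < k) ((x *+ i - x *+ k)%R == c) = \sum_(m < k) ((- (x *+ m.+1))%R == c))%N.
Proof.
rewrite (reindex_inj rev_ord_inj); apply: eq_bigr => i _ /=.
have -> : x *+ k = x *+ (k - i.+1) + x *+ i.+1 by rewrite -mulrnDr subnK.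
by rewrite opprD addrA subrr add0r.
Qed.

Lemma diff_mulrn_high k :
  (\sum_(j < k.+1) ((x *+ k - x *+ j)%R == c) = \sum_(m < k.+1) (x *+ m == c))%N.
Proof.
rewrite (reindex_inj rev_ord_inj); apply: eq_bigr => i _ /=.
by rewrite subSS -mulrnBr ?leq_subr // subKn // -ltnS.
Qed.

(** Induction on k. The new row i = k contributes 0, x, ..., (k + 1) x, and the new column j = k + 1
    contributes -x, ..., -k x in the old rows. *)
Lemma spectrum_count k :
  (\sum_(i < k) \sum_(j < k.+1) ((x *+ i.+1 - x *+ j)%R == c) =
   \sum_(m < k) (k - m) * (((- (x *+ m))%R == c) + (x *+ m.+1 == c)))%N.
Proof.
elim: k => [|k IHk]; first by rewrite !big_ord0.
rewrite (sum_subn_mul (fun m => ((- (x *+ m))%R == c) + (x *+ m.+1 == c)))%N -{}IHk.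
rewrite big_ord_recr /= diff_mulrn_high.
under eq_bigr do rewrite big_ord_recr /=.
rewrite !big_split -addnA /=; congr addn.
(* This instance also counts i = 0, which does not occur in the column; its difference -(k + 1) x is
   cancelled on both sides. *)
have := diff_mulrn_low k.+1; rewrite big_ord_recl [in RHS]big_ord_recr /=.
rewrite mulr0n sub0r addnC => /addIn ->.
rewrite [X in (_ + X)%N = _]big_ord_recl [X in _ = (X + _)%N]big_ord_recl /=.
rewrite !mulr0n oppr0.
by rewrite addnCA addnA.
Qed.

(** The same induction on a square: the new row gives 0, x, ..., (k + 1) x and the new column -x,
    ..., -(k + 1) x. *)
Lemma extended_spectrum_count k :
  (\sum_(i < k.+1) \sum_(j < k.+1) ((x *+ i - x *+ j)%R == c) =
   k.+1 * (0%R == c) +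
   \sum_(m < k) (k - m) * (((- (x *+ m.+1))%R == c) + (x *+ m.+1 == c)))%N.
Proof.
elim: k => [|k IHk]; first by rewrite !big_ord1 big_ord0 subrr mul1n addn0.
rewrite (sum_subn_mul (fun m => ((- (x *+ m.+1))%R == c) + (x *+ m.+1 == c)))%N.
rewrite mulSn -addnA [X in (_ = _ + X)%N]addnA -{}IHk.
rewrite big_ord_recr /= diff_mulrn_high big_ord_recl.
under eq_bigr do rewrite big_ord_recr /=.
rewrite !big_split /= diff_mulrn_low mulr0n.
by rewrite addnCA -!addnA.
Qed.

End DifferenceCount.

(** * Simple paths on the integer line *)

Definition line_edge (x y : nat) : bool := (x == y.+1) || (y == x.+1).

(** The starting point x is left out, following the convention of [path]. *)
Definition line (x y : nat) : seq nat :=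
  if (x <= y)%N then iota x.+1 (y - x) else rev (iota y (x - y)).

Lemma mem_line x y z :
  (z \in line x y) = ((x < z <= y) || (y <= z < x))%N.
Proof. by rewrite /line; case: ifP => xy; rewrite ?mem_rev mem_iota; lia. Qed.

Lemma line_uniq x y : uniq (x :: line x y).
Proof.
rewrite /= mem_line; apply/andP; split; first by lia.
by rewrite /line; case: ifP; rewrite ?rev_uniq iota_uniq.
Qed.

Lemma line_up x y : (x < y)%N -> line x y = x.+1 :: line x.+1 y.
Proof.
move=> xy; rewrite /line xy (ltnW xy) subnS.
by case: (y - x)%N (subn_gt0 x y) => [|m] //; lia.
Qed.

Lemma line_down x y : (y <= x)%N -> line x.+1 y = x :: line x y.
Proof.
move=> yx; rewrite /line ltnNge yx /= subSn // -addn1 iotaD rev_cat /= subnKC //.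
case: leqP => // xy; have -> : x = y by lia.
by rewrite subnn.
Qed.

Lemma line_path x y : path line_edge x (line x y) /\ last x (line x y) = y.
Proof.
have [xy|yx] := leqP x y.
  rewrite -(subnKC xy); move: (y - x)%N => m; elim: m x {xy} => [|m IHm] x.
    by rewrite addn0 /line leqnn subnn.
  rewrite line_up ?addnS ?ltnS ?leq_addr //= -addSn.
  by have [-> ->] := IHm x.+1; rewrite /line_edge eqxx orbT.
rewrite -(subnKC (ltnW yx)); move: (x - y)%N => m; elim: m {yx} => [|m IHm].
  by rewrite addn0 /line leqnn subnn.
rewrite addnS line_down ?leq_addr //=.
by have [-> ->] := IHm; rewrite /line_edge eqxx.
Qed.

(** By induction the tail is a [line]; had the first step moved away from the endpoint, this tail
    would pass through x again. *)
Lemma uniq_line_path x p :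
  path line_edge x p -> uniq (x :: p) -> p = line x (last x p).
Proof.
elim: p x => [|y p IHp] x /=; first by rewrite /line leqnn subnn.
case/andP=> xy /IHp pE /andP[xNp /pE {}pE].
move: pE; set z := last y p => pE.
move: xNp; rewrite inE pE mem_line.
case/orP: xy => /eqP -> xNp; first by rewrite line_down //; lia.
by rewrite (line_up x) //; lia.
Qed.

(** * The meander *)

Section MeanderOfAff.

Variable k : nat.
Local Notation n := k.+1.
Local Notation a := [:: k; 1%N].
Local Notation b := [:: n].

(* The meander is the path v_(k+1), v_1, v_k, v_2, v_(k-1), ...; [meander_pos]
   is the position of a vertex in it. *)
Definition meander_pos (v : nat) : nat :=
  if (v.*2 < k)%N then v.*2.+1 else (k - v)%N.*2.

Definition meander_vtx (p : nat) : 'I_n :=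
  inord (if odd p then p./2 else (k - p./2)%N).

Lemma meander_pos_le (v : 'I_n) : (meander_pos v <= k)%N.
Proof. by rewrite /meander_pos; case: ltnP => vk; have := ltn_ord v; lia. Qed.

Lemma meander_posK (v : 'I_n) : meander_vtx (meander_pos v) = v.
Proof.
have vn := ltn_ord v; apply/val_inj; rewrite /meander_vtx /meander_pos.
by case: ltnP => vk; rewrite ?oddS ?odd_double /= ?uphalf_double ?doubleK inordK; lia.
Qed.

Lemma meander_vtxK p : (p <= k)%N -> meander_pos (meander_vtx p) = p.
Proof.
move=> pk; rewrite /meander_vtx /meander_pos inordK; last by case: ifP; lia.
by have := odd_double_half p; case: (odd p) => /=; case: ltnP; lia.
Qed.

(** Bottom edges (u + v = k) pair the positions 2q and 2q + 1, top edges (u + v = k - 1) the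
    positions 2q + 1 and 2q + 2; both orientations lower the position by one. *)
Lemma meander_arcE (u v : 'I_n) :
  meander_arc a b u v = (meander_pos u == (meander_pos v).+1).
Proof.
have := ltn_ord u; have := ltn_ord v.
rewrite /meander_arc /block_edge /= /meander_pos !orbF !addn0 !add0n -val_eqE /=.
rewrite /take /=; case: (ltnP u.*2); case: (ltnP v.*2); lia.
Qed.

(** Each traversed edge contributes the drop in position, so the sum telescopes. *)
Lemma meander_path_weight (i : 'I_n) (p : seq 'I_n) :
  path (meander_edge a b) i p ->
  path_weight a b i p = (meander_pos i)%:Z - (meander_pos (last i p))%:Z.
Proof.
rewrite /path_weight; elim: p i => [|j p IHp] i /=.
  by rewrite big_nil subrr.
case/andP=> ij /IHp {}IHp; rewrite big_cons IHp.
by move: ij; rewrite /meander_edge !meander_arcE; lia.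
Qed.

Definition meander_walk (i j : 'I_n) : seq 'I_n :=
  [seq meander_vtx p | p <- line (meander_pos i) (meander_pos j)].

Lemma map_meander_walk i j :
  [seq meander_pos v | v : 'I_n <- meander_walk i j] =
  line (meander_pos i) (meander_pos j).
Proof.
rewrite -map_comp map_id_in // => p; rewrite mem_line => pij /=.
by rewrite meander_vtxK //; have := (meander_pos_le i, meander_pos_le j) => -[]; lia.
Qed.

Lemma meander_pos_inj : injective (fun v : 'I_n => meander_pos v).
Proof. exact: can_inj meander_posK. Qed.

(** The injection [meander_pos] carries the meander to the integer line, where simple paths are
    unique. *)
Lemma meander_pathP (i j : 'I_n) (p : seq 'I_n) :
  meander_path a b i j p <-> p = meander_walk i j.
Proof.
pose f (v : 'I_n) := meander_pos v.
have f_inj : injective f by exact: meander_pos_inj.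
have fE (v : 'I_n) q : path (meander_edge a b) v q = path line_edge (f v) (map f q).
  rewrite path_map; apply: eq_path => u w.
  by rewrite /meander_edge !meander_arcE /line_edge.
have fw : map f (meander_walk i j) = line (f i) (f j).
  exact: map_meander_walk.
rewrite /meander_path fE -(map_inj_uniq f_inj) /=.
split=> [[pp pu pl]|->].
  apply: (inj_map f_inj).
  by rewrite fw [LHS](uniq_line_path _ _ pp pu) last_map pl.
rewrite fw; have [-> fl] := line_path (f i) (f j); split=> //.
  exact: line_uniq.
by apply: f_inj; rewrite -last_map fw.
Qed.

Lemma meander_extended_spectrum :
  is_extended_spectrum n a b
    (msetn k (0 : int) `+`
     \big[msetD/mset0]_(0 <= i < k)
       (msetn i.+1 (- k%:Z + i%:Z) `+` msetn i.+1 (k%:Z - i%:Z))).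
Proof.
exists meander_walk; split=> [i j|].
  by split=> [|p /meander_pathP]; [apply/meander_pathP|].
apply/msetP => c; rewrite !msetE2 mset_seqE count_allpairs_ord big_msetDE.
rewrite [X in (X - _)%N](_ : _ =
  \sum_(i < n) \sum_(j < n) ((i%:R - j%:R : int)%R == c))%N.
  (* The diagonal i = j gives k + 1 zeros, and removing a single 0 leaves k. *)
  rewrite extended_spectrum_count !msetn_mul mul1n mulSn -addnA addKn.
  congr addn; rewrite big_mkord (reindex_inj rev_ord_inj); apply: eq_bigr => i _ /=.
  have ik := ltn_ord i; rewrite msetE2 !msetn_mul !natz -subSn // subSS mulnDr.
  have -> : - k%:Z + (k - i.+1)%:Z = - i.+1%:Z by lia.
  by have -> : k%:Z - (k - i.+1)%:Z = i.+1%:Z by lia.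
have vtx_bij : {on predT, bijective (fun p : 'I_n => meander_vtx p)}.
  exists (fun v => inord (meander_pos v)) => v _; last first.
    by rewrite inordK ?meander_posK // ltnS meander_pos_le.
  by rewrite meander_vtxK ?inord_val // -ltnS.
rewrite (reindex _ vtx_bij); apply: eq_bigr => p _.
rewrite (reindex _ vtx_bij); apply: eq_bigr => q _.
have [walk_path _ last_walk] := (meander_pathP (meander_vtx p) (meander_vtx q) _).2 erefl.
rewrite meander_path_weight // last_walk !meander_vtxK -1?ltnS //.
by rewrite !natz.
Qed.

End MeanderOfAff.

(** * Krylov matrices *)

(** The two sizes are kept distinct so that the lemma applies to sizes that are only provably equal,
    such as a dimension and k * n. *)
Lemma char_poly_similar (R : comNzRingType) m n (A : 'M[R]_m) (D : 'M[R]_n)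
    (P : 'M[R]_(m, n)) (Q : 'M[R]_(n, m)) :
  P *m Q = 1%:M -> Q *m P = 1%:M -> A *m P = P *m D -> char_poly A = char_poly D.
Proof.
move=> PQ QP; have mn : m = n.
  by apply/eqP; rewrite eqn_leq (mulmx1_min PQ) (mulmx1_min QP).
subst n => AP.
have XP : char_poly_mx A *m map_mx polyC P = map_mx polyC P *m char_poly_mx D.
  by rewrite mulmxBl mulmxBr -!map_mxM AP scalar_mxC.
have detPQ : \det (map_mx polyC P) * \det (map_mx polyC Q) = 1 :> {poly R}.
  by rewrite -det_mulmx -map_mxM PQ map_mx1 det1.
rewrite /char_poly -[LHS]mulr1 -detPQ mulrA -det_mulmx XP det_mulmx.
by rewrite mulrC mulrA [_ * \det (map_mx polyC P)]mulrC detPQ mul1r.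
Qed.

Lemma char_poly_trmx (R : comNzRingType) n (A : 'M[R]_n) : char_poly A^T = char_poly A.
Proof.
rewrite /char_poly -det_tr; congr (\det _).
by rewrite /char_poly_mx linearB /= tr_scalar_mx map_trmx trmxK.
Qed.

Lemma perm_eq_prod_XsubC (F : fieldType) (s t : seq F) :
  \prod_(x <- s) ('X - x%:P) = \prod_(x <- t) ('X - x%:P) -> perm_eq s t.
Proof. by move=> st; apply/allP => x _ /=; rewrite -!mu_prod_XsubC st. Qed.

Section Krylov.

Variables (F : fieldType) (m : nat).
Local Notation k := m.+1.
Variables (phi : 'rV[F]_k) (M : 'M[F]_k).

Definition krylov : 'M[F]_k := \matrix_(i < k) (phi *m M ^+ i).

Lemma row_krylov i : row i krylov = phi *m M ^+ i.
Proof. exact: rowK. Qed.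

(** By Cayley-Hamilton q may be reduced modulo the characteristic polynomial of M; the remainder
    involves only the powers of M that give rows of [krylov]. *)
Lemma horner_krylov (q : {poly F}) : (phi *m horner_mx M q <= krylov)%MS.
Proof.
set p := char_poly M.
have p_neq0 : p != 0 by rewrite monic_neq0 // char_poly_monic.
have -> : horner_mx M q = horner_mx M (q %% p).
  rewrite {1}(divp_eq q p) rmorphD rmorphM /= [horner_mx M p]Cayley_Hamilton.
  by rewrite mulr0 add0r.
have : (size (q %% p)%R <= k)%N by rewrite -ltnS -[k.+1](size_char_poly M) ltn_modp.
move: (q %% p) => r rk.
have -> : r = \poly_(i < k) r`_i.
  by apply/polyP => i; rewrite coef_poly; case: ltnP => // /(leq_trans rk)/leq_sizeP ->.
rewrite poly_def linear_sum mulmx_sumr summx_sub // => i _.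
rewrite linearZ rmorphXn /= horner_mx_X -scalemxAr scalemx_sub //.
by rewrite -row_krylov row_sub.
Qed.

Lemma krylov_stable : (krylov *m M <= krylov)%MS.
Proof.
apply/row_subP => i; rewrite row_mul row_krylov -mulmxA -[_ *m M]exprSr.
by rewrite -(horner_mx_X M) -rmorphXn horner_krylov.
Qed.

(** Here phi M^i v = tr (M^i (M A - A M)) = 0 for all i, so v = 0. Then A commutes with M, and phi
    M^i A = phi A M^i = 0 gives A = 0. *)
Lemma krylov_radical0 (A : 'M[F]_k) (v : 'cV[F]_k) :
  krylov \in unitmx -> phi *m A = 0 -> M *m A - A *m M = v *m phi ->
  v = 0 /\ A = 0.
Proof.
move=> C_unit phiA MA.
have v0 : v = 0.
  apply: (can_inj (mulKmx C_unit)); rewrite mulmx0; apply/row_matrixP => i.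
  rewrite row_mul row_krylov row0; apply/matrixP => x y; rewrite !ord1 [RHS]mxE.
  rewrite -[LHS]trace_mx11 -mulmxA mxtrace_mulC -mulmxA -MA mulmxBr raddfB /=.
  have MX : M ^+ i *m M = M *m M ^+ i by rewrite -[LHS]exprSr -[RHS]exprS.
  rewrite mulmxA [\tr (_ *m A)]mxtrace_mulC [\tr (M ^+ i *m _)]mxtrace_mulC.
  by rewrite -mulmxA -MX subrr.
split=> //; move/eqP: MA; rewrite v0 mul0mx subr_eq0 => /eqP MA.
have MXA i : M ^+ i *m A = A *m M ^+ i.
  exact/esym/(commrX i (esym MA : GRing.comm A M)).
apply: (can_inj (mulKmx C_unit)); rewrite mulmx0; apply/row_matrixP => i.
by rewrite row_mul row_krylov row0 -mulmxA MXA mulmxA phiA mul0mx.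
Qed.

(** Induction through phi M^(i+1) A = phi M^i (A M + M + v phi): the first term shifts the previous
    expansion by one power, the second raises the leading coefficient by one, the third is a
    multiple of phi. *)
Lemma krylov_principal (A : 'M[F]_k) (v : 'cV[F]_k) i :
  phi *m A = phi -> M *m A - A *m M = M + v *m phi ->
  exists c : nat -> F, phi *m M ^+ i *m A =
    i.+1%:R *: (phi *m M ^+ i) + \sum_(j < i) c j *: (phi *m M ^+ j).
Proof.
move=> phiA /(canRL (subrK _)) MA; elim: i => [|i [c IHi]].
  by exists (fun=> 0); rewrite big_ord0 mulmx1 phiA scale1r addr0.
have [x xE] : exists x, phi *m M ^+ i *m v = x%:M.
  by exists ((phi *m M ^+ i *m v) 0 0); exact: mx11_scalar.
(* The old coefficients move up one power, and the scalar x = phi M^i v becomes the coefficient of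
   phi. *)
exists (fun j => if j is j'.+1 then c j' else x).
rewrite exprSr mulmxA -mulmxA MA !mulmxDr !mulmxA IHi xE mul_scalar_mx.
rewrite big_ord_recl mulmx1 mulmxDl -scalemxAl mulmx_suml.
rewrite [i.+2%:R]mulrSr scalerDl scale1r.
under eq_bigr do rewrite -scalemxAl -[_ *m M ^+ _ *m M]mulmxA -[_ *m M]exprSr.
under [in RHS]eq_bigr do rewrite lift0.
by rewrite -!addrA [RHS]addrCA; congr (_ + _); rewrite addrCA.
Qed.

(** In the basis of Krylov rows, A becomes lower triangular with diagonal 1, ..., k. *)
Lemma krylov_char_poly (A : 'M[F]_k) (v : 'cV[F]_k) :
  krylov \in unitmx -> phi *m A = phi -> M *m A - A *m M = M + v *m phi ->
  char_poly A = \prod_(i < k) ('X - (i.+1%:R)%:P).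
Proof.
move=> C_unit phiA MA.
have [L LE] : exists L, L = krylov *m A *m invmx krylov.
  by exists (krylov *m A *m invmx krylov).
have rowL (i j : 'I_k) : (i <= j)%N -> L i j = i.+1%:R *+ (i == j).
  move=> ij; have [c rE] := krylov_principal _ _ i phiA MA.
  have : row i L = i.+1%:R *: delta_mx 0 i + \sum_(l < i) c l *: delta_mx 0 (inord l).
    have e (l : 'I_k) : phi *m M ^+ l *m invmx krylov = delta_mx 0 l.
      by rewrite -row_krylov -row_mul mulmxV // row1.
    rewrite LE !row_mul row_krylov rE mulmxDl -scalemxAl e mulmx_suml; congr (_ + _).
    apply: eq_bigr => l _; rewrite -scalemxAl -e inordK //.
    exact: ltn_trans (ltn_ord l) (ltn_ord i).
  move/rowP/(_ j); rewrite !mxE summxE big1 => [->|l _].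
    by rewrite addr0 eqxx mulr_natr eq_sym.
  rewrite !mxE eqxx -val_eqE /= inordK; last exact: ltn_trans (ltn_ord l) (ltn_ord i).
  by rewrite gtn_eqF ?mulr0 // (leq_trans (ltn_ord l)).
have L_trig : is_trig_mx L.
  apply/is_trig_mxP => i j ij; rewrite rowL 1?ltnW // -val_eqE.
  by rewrite (ltn_eqF ij) mulr0n.
rewrite (char_poly_similar _ _ _ _ L (invmx krylov) krylov) ?mulVmx ?mulmxV //.
  by rewrite char_poly_trig //; apply: eq_bigr => i _; rewrite rowL // eqxx.
by rewrite LE !mulmxA mulVmx // mul1mx.
Qed.

End Krylov.

(** The row space of [krylov] is stable under M, so its annihilator W is stable under M^T and, being
    nonzero, contains an eigenvector over a closed field. *)
Lemma krylov_radical_neq0 (F : numClosedFieldType) m (phi : 'rV[F]_m.+1) (M : 'M_m.+1) :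
  krylov _ _ phi M \notin unitmx ->
  exists2 A : 'M_m.+1, A != 0 & phi *m A = 0 /\ M *m A = A *m M.
Proof.
set C := krylov _ _ phi M => C_sing; set W := kermx C^T.
have W_neq0 : W != 0 by rewrite kermx_eq0 row_free_unit unitmx_tr.
have WM : (W *m M^T <= W)%MS.
  apply/sub_kermxP; rewrite -mulmxA -trmx_mul.
  have /submxP[D ->] := krylov_stable _ _ phi M.
  by rewrite trmx_mul mulmxA mulmx_ker mul0mx.
(* D is the matrix of M^T restricted to W. *)
have [D WD] : exists D, row_base W *m M^T = D *m row_base W.
  by apply/submxP; rewrite !eq_row_base (eqmxMr _ (eq_row_base W)).
have [|a /eigenvalueP[u uD u_neq0]] := eigenvalue_closed D.
  by rewrite lt0n mxrank_eq0.
pose w := u *m row_base W.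
have w_neq0 : w != 0 by rewrite mulmx_free_eq0 // row_base_free.
have wM : w *m M^T = a *: w by rewrite -mulmxA WD mulmxA uD scalemxAl.
have wC : w *m C^T = 0.
  apply/sub_kermxP; apply: submx_trans (submxMl _ _) _.
  by rewrite eq_row_base.
(* M and M^T have the same characteristic polynomial, hence the same eigenvalues. *)
have [r rM r_neq0] : exists2 r : 'rV_m.+1, r *m M = a *: r & r != 0.
  apply/eigenvalueP; rewrite eigenvalue_root_char -char_poly_trmx.
  by rewrite -eigenvalue_root_char; apply/eigenvalueP; exists w.
exists (w^T *m r).
  have /rV0Pn[i wi] := w_neq0; have /rV0Pn[j rj] := r_neq0.
  apply/eqP => /matrixP/(_ i j); rewrite !mxE big_ord1 mxE => /eqP.
  by rewrite mulf_eq0 (negPf wi) (negPf rj).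
split.
  have : (C *m w^T) = 0 by apply: trmx_inj; rewrite trmx_mul trmxK wC trmx0.
  move/(congr1 (row 0)); rewrite row_mul row_krylov mulmx1 row0 mulmxA => ->.
  by rewrite mul0mx.
have -> : M *m (w^T *m r) = (w *m M^T)^T *m r by rewrite [in RHS]trmx_mul trmxK mulmxA.
by rewrite wM -mulmxA rM linearZ /= -scalemxAl -scalemxAr.
Qed.

(** The minimal polynomial divides a product of distinct linear factors; comparing characteristic
    polynomials then identifies the diagonal up to order. *)
Lemma diagonalize_char_poly (F : fieldType) m (A : 'M[F]_m.+1) (s : seq F) :
  uniq s -> char_poly A = \prod_(x <- s) ('X - x%:P) ->
  exists2 P : 'M_m.+1, P \in unitmx &
    exists2 d : 'rV_m.+1, P *m A = diag_mx d *m P &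
      perm_eq [seq d 0 i | i <- enum 'I_m.+1] s.
Proof.
move=> s_uniq A_char.
have /diagonalizableP[P P_unit /diagonalizable_forPex[d /(simmxP P_unit) PA]] :
    exists2 rs, uniq rs & mxminpoly A %| \prod_(x <- rs) ('X - x%:P).
  by exists s => //; rewrite -A_char mxminpoly_dvd_char.
exists P => //; exists d => //; apply: perm_eq_prod_XsubC; rewrite -A_char.
rewrite (char_poly_similar _ _ _ A (diag_mx d) (invmx P) P) ?mulmxV ?mulVmx //.
  rewrite char_poly_trig; last exact/diag_mx_is_trig.
  by rewrite big_map big_enum; apply: eq_bigr => i _; rewrite mxE eqxx.
by rewrite -{1}[A](mulKmx P_unit) PA mulmxA mulmxK.
Qed.

(** * The seaweed in coordinates *)

(** Eigenvalues are defined through the unspecified basis [vbasis]; this allows them to be computed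
    in any convenient coordinates T, with inverse S. *)
Lemma char_poly_mxof (F : fieldType) (V : vectType F) (f : 'End(V)) N (D : 'M[F]_N)
    (T : {linear V -> 'rV[F]_N}) (S : {linear 'rV[F]_N -> V}) :
  cancel T S -> cancel S T -> (forall v, T (f v) = T v *m D) ->
  char_poly (mxof (vbasis {:V}) (vbasis {:V}) f) = char_poly D.
Proof.
move=> TK SK Tf; set e := vbasis {:V}; have e_basis : basis_of {:V} e by exact: vbasisP.
apply: (char_poly_similar _ _ _ _ _ (lin1_mx (T \o vecof e)) (lin1_mx (rVof e \o S))).
- apply/row_matrixP => i; rewrite !rowE mulmxA !mul_rV_lin1 /= TK vecofK //.
  by rewrite mulmx1.
- apply/row_matrixP => i; rewrite !rowE mulmxA !mul_rV_lin1 /= rVofK // SK.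
  by rewrite mulmx1.
apply/row_matrixP => i; rewrite !rowE !mulmxA mul_mxof !mul_rV_lin1 /= rVofK //.
Qed.

(** Nondegeneracy makes x |-> f o ad x injective into the dual, hence bijective by dimension; the
    preimage of f is the principal element. *)
Lemma frobenius_principal (F : fieldType) (g : lieAlgType F) (f : 'Hom(g, F^o)) :
  frobenius_functional f -> exists x, unique (principal_element f) x.
Proof.
move=> f_frob; pose Phi (x : g) : 'Hom(g, F^o) := (f \o ad x)%VF.
have Phi_linear : linear Phi.
  move=> c x y; apply/lfunP => z.
  rewrite add_lfunE scale_lfunE !comp_lfunE !adE.
  by have /= -> := lie_linearl z c x y; rewrite linearP.
pose PhiL := GRing.isLinear.Build F g 'Hom(g, F^o) _ Phi Phi_linear.
pose L : {linear g -> 'Hom(g, F^o)} := HB.pack Phi PhiL.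
have LE x y : linfun L x y = f (lie x y) by rewrite lfunE /= !lfunE /= lfunE.
have L_ker : lker (linfun L) == 0%VS.
  apply/lker0P => x y xy; apply/eqP; rewrite -subr_eq0; apply/eqP/f_frob => z.
  by rewrite -LE linearB /= xy subrr lfunE.
have L_img : limg (linfun L) = fullv.
  apply/eqP; rewrite eqEdim subvf limg_dim_eq ?(eqP L_ker) ?capv0 //=.
  by rewrite !dimvf /dim /= muln1.
have /memv_imgP[x _ fx] : f \in limg (linfun L) by rewrite L_img memvf.
exists x; split=> [y|x' x'P]; first by rewrite -LE -fx.
apply/eqP; rewrite -subr_eq0; apply/eqP/f_frob => z.
by rewrite -LE linearB /= lfunE /= lfunE /= -fx LE x'P subrr.
Qed.

(** Nondegeneracy of the trace pairing: an elementary matrix reads off one entry of Y. *)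
Lemma mxtrace_mul_eq0 (R : nzRingType) m n (Y : 'M[R]_(m, n)) :
  (forall X : 'M_(n, m), \tr (Y *m X) = 0) -> Y = 0.
Proof.
move=> Y0; apply/matrixP => i j; rewrite mxE -[RHS](Y0 (delta_mx j i)).
rewrite /mxtrace (bigD1 i) //= big1 ?addr0 => [|l li]; rewrite mxE.
  rewrite (bigD1 j) //= big1 ?addr0 => [|q qj]; rewrite mxE !eqxx ?mulr1 //.
  by rewrite (negPf qj) mulr0.
by rewrite big1 // => q _; rewrite mxE (negPf li) andbF mulr0.
Qed.

Lemma mem_span_delta (F : fieldType) n (P : pred 'I_n) (u : 'cV[F]_n) :
  (u \in span [seq delta_mx j 0 | j : 'I_n <- enum 'I_n & P j]) <->
  (forall i, ~~ P i -> u i 0 = 0).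
Proof.
split=> [|u0].
  rewrite span_def big_map big_filter big_enum_cond.
  case/memv_sumP => w wP -> i Pi; rewrite summxE big1 // => j jP.
  have /andP[_ Pj] := jP; have /vlineP[c ->] := wP j jP; rewrite !mxE.
  by case: eqP => [ij|_]; rewrite ?mulr0 //; rewrite ij Pj in Pi.
rewrite [u]matrix_sum_delta; apply: memv_suml => i _; apply: memv_suml => j _.
rewrite ord1; have [Pi|/u0->] := boolP (P i); last by rewrite scale0r mem0v.
by rewrite memvZ // memv_span //; apply/mapP; exists i; rewrite // mem_filter Pi mem_enum.
Qed.

(** * Splitting off the last coordinate *)

Section Corner.

Variables (R : comNzRingType) (k : nat).
Local Notation n := k.+1.

Definition corner_mx : 'M[R]_(n, k) :=
  \matrix_(i < n, j < k) (i == widen_ord (leqnSn k) j)%:R.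

Definition last_cv : 'cV[R]_n := delta_mx ord_max 0.

Local Notation J := corner_mx.
Local Notation e := last_cv.

Lemma corner_mulmxl p (X : 'M[R]_(n, p)) i j :
  (J^T *m X) i j = X (widen_ord (leqnSn k) i) j.
Proof.
rewrite mxE (bigD1 (widen_ord (leqnSn k) i)) //= !mxE eqxx mul1r big1 ?addr0 //.
by move=> l li; rewrite !mxE (negPf li) mul0r.
Qed.

Lemma corner_mulmxr p (X : 'M[R]_(p, n)) i j :
  (X *m J) i j = X i (widen_ord (leqnSn k) j).
Proof. by rewrite -[X *m J]trmxK trmx_mul mxE corner_mulmxl mxE. Qed.

Lemma last_mulmxl p (X : 'M[R]_(n, p)) : e^T *m X = row ord_max X.
Proof. by rewrite trmx_delta -rowE. Qed.

Lemma corner_trmx_mul : J^T *m J = 1%:M.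
Proof. by apply/matrixP => i j; rewrite corner_mulmxl !mxE -!val_eqE. Qed.

Lemma last_mul_corner : e^T *m J = 0.
Proof.
apply/matrixP => i j; rewrite last_mulmxl !mxE -val_eqE /= gtn_eqF //.
Qed.

Lemma corner_mul_last : J^T *m e = 0.
Proof. by apply: trmx_inj; rewrite trmx_mul trmxK last_mul_corner trmx0. Qed.

Lemma last_trmx_mul : e^T *m e = 1%:M.
Proof. by rewrite last_mulmxl; apply/matrixP => i j; rewrite !mxE !ord1 !eqxx. Qed.

(** J^T X consists of the first k rows of X, and e^T X is its last row. *)
Lemma corner_last_inj p (X Y : 'M[R]_(n, p)) :
  J^T *m X = J^T *m Y -> e^T *m X = e^T *m Y -> X = Y.
Proof.
rewrite !last_mulmxl => /matrixP XY /matrixP XY_last; apply/matrixP => i j.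
have [ik|ki] := ltnP i k.
  have := XY (Ordinal ik) j; rewrite !corner_mulmxl.
  by have -> : widen_ord (leqnSn k) (Ordinal ik) = i by apply/val_inj.
have -> : i = ord_max by apply/val_inj/eqP; rewrite eqn_leq ki -ltnS ltn_ord.
by have := XY_last 0 j; rewrite !mxE.
Qed.

Lemma corner_decomp : J *m J^T + e *m e^T = 1%:M.
Proof.
apply: corner_last_inj; rewrite mulmx1 mulmxDr !mulmxA.
  by rewrite corner_trmx_mul corner_mul_last mul1mx mul0mx addr0.
by rewrite last_mul_corner last_trmx_mul mul1mx mul0mx add0r.
Qed.

End Corner.

Lemma mxvec_mul_diag (R : comNzRingType) m n (Z c : 'M[R]_(m, n)) :
  mxvec Z *m diag_mx (mxvec c) = mxvec (\matrix_(i, j) (Z i j * c i j)).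
Proof.
apply/rowP => l; case/mxvec_indexP: l => i j.
by rewrite mul_mx_diag [LHS]mxE !mxvecE mxE.
Qed.

(** * The seaweed as the space of k x n matrices *)

Section Aff.

Variables (K : numClosedFieldType) (m : nat).
Local Notation k := m.+1.
Local Notation n := k.+1.
Local Notation J := (corner_mx K k).
Local Notation e := (last_cv K k).
Local Notation g := (seaweed K n [:: k; 1%N] [:: n] : lieAlgType K).

(** Of all the flag members only V_1 gives a condition; the others are 0 or the whole space. *)
Lemma mem_seaweed (x : 'M[K]_n) :
  (x \in seaweed_space K n [:: k; 1%N] [:: n]) <-> \tr x = 0 /\ e^T *m x *m J = 0.
Proof.
split=> [/seaweed_spaceP[x_tr xV _]|[x_tr xJ]].
  split=> //; apply/matrixP => i j; rewrite corner_mulmxr last_mulmxl !mxE.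
  have jV : (delta_mx (widen_ord (leqnSn k) j) 0 : 'cV_n) \in flagV K n [:: k; 1%N] 1.
    apply/mem_span_delta => l /=; rewrite addn0 -leqNgt => kl; rewrite mxE -val_eqE /=.
    by rewrite gtn_eqF // (leq_trans (ltn_ord j)).
  have /mem_span_delta xjV := xV 1%N isT _ jV.
  by have := xjV ord_max; rewrite /= addn0 ltnn -colE mxE; apply.
have all_mem (P : pred 'I_n) (u : 'cV[K]_n) : P =1 predT ->
    u \in span [seq delta_mx j 0 | j : 'I_n <- enum 'I_n & P j].
  by move=> PT; apply/mem_span_delta => i; rewrite PT.
have none_mem (P : pred 'I_n) (u : 'cV[K]_n) : P =1 pred0 ->
    u \in span [seq delta_mx j 0 | j : 'I_n <- enum 'I_n & P j] ->
    x *m u \in span [seq delta_mx j 0 | j : 'I_n <- enum 'I_n & P j].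
  move=> P0 /mem_span_delta u0; have -> : u = 0.
    by apply/colP => i; rewrite mxE u0 ?P0.
  by rewrite mulmx0 mem0v.
apply/seaweed_spaceP; split=> // [[|[|[|//]]] _ u|[|[|//]] _ u].
- by apply: none_mem => i; rewrite /= ltn0.
- move/mem_span_delta => uV; apply/mem_span_delta => i /=; rewrite addn0 -leqNgt => ki.
  have -> : i = ord_max by apply/val_inj/eqP; rewrite eqn_leq ki -ltnS ltn_ord.
  have -> : (x *m u) ord_max 0 = (e^T *m x *m u) 0 0.
    by rewrite -mulmxA last_mulmxl [RHS]mxE.
  rewrite -[u]mul1mx -(corner_decomp K k) mulmxDl mulmxDr !mulmxA xJ !mul0mx add0r.
  have eu : e^T *m u = 0.
    by apply/matrixP => r s; rewrite last_mulmxl !mxE !ord1 uV //= addn0 ltnn.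
  by rewrite -mulmxA eu mulmx0 mxE.
- by move=> _; apply: all_mem => i; rewrite /= addn0 addn1 ltn_ord.
- by move=> _; apply: all_mem => i; rewrite /= leq0n.
- by apply: none_mem => i; rewrite /= addn0 leqNgt ltn_ord.
Qed.

(** The last row of x is zero off the diagonal, so subtracting this scalar matrix kills it; the
    remaining k rows are unconstrained. *)
Definition aff_coord (x : g) : 'M[K]_(k, n) :=
  J^T *m (vsval x - (vsval x ord_max ord_max)%:M).

Lemma aff_coord_linear : linear aff_coord.
Proof.
move=> c x y; rewrite /aff_coord linearP /=; move: (vsval x) (vsval y) => X Y.
rewrite [(c *: X + Y) _ _]mxE [(c *: X) _ _]mxE [(_ + _)%:M]raddfD /= -scale_scalar_mx.
by rewrite opprD addrACA -scalerBr mulmxDr -scalemxAr.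
Qed.

HB.instance Definition _ :=
  GRing.isLinear.Build K g 'M[K]_(k, n) _ aff_coord aff_coord_linear.

(** The scalar term restores trace zero, n being invertible in characteristic 0. *)
Definition aff_mx (N : 'M[K]_(k, n)) : 'M[K]_n := J *m N - (\tr (J *m N) / n%:R)%:M.

Lemma aff_mx_last N : e^T *m aff_mx N = - (\tr (J *m N) / n%:R) *: e^T.
Proof. by rewrite mulmxBr mulmxA last_mul_corner mul0mx sub0r mul_mx_scalar scaleNr. Qed.

Lemma aff_mx_mem N : aff_mx N \in seaweed_space K n [:: k; 1%N] [:: n].
Proof.
apply/mem_seaweed; split; last first.
  by rewrite aff_mx_last -scalemxAl last_mul_corner scaler0.
by rewrite raddfB /= mxtrace_scalar -[_ / _ *+ n]mulr_natr divfK ?subrr // pnatr_eq0.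
Qed.

Definition aff_of (N : 'M[K]_(k, n)) : g := Subvs (aff_mx_mem N).

Lemma aff_of_linear : linear aff_of.
Proof.
move=> c X Y; apply/val_inj; rewrite /= /aff_mx linearP /= linearP /=.
rewrite mulrDl -mulrA raddfD /= -scale_scalar_mx scalerBr opprD addrACA.
by [].
Qed.

HB.instance Definition _ :=
  GRing.isLinear.Build K 'M[K]_(k, n) g _ aff_of aff_of_linear.

Lemma aff_ofK : cancel aff_of aff_coord.
Proof.
move=> X; rewrite /aff_coord /=.
have -> : aff_mx X ord_max ord_max = - (\tr (J *m X) / n%:R).
  have /matrixP/(_ 0 ord_max) := aff_mx_last X.
  by rewrite last_mulmxl !mxE !eqxx mulr1.
rewrite raddfN /= opprK subrK.
by rewrite mulmxA corner_trmx_mul mul1mx.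
Qed.

Lemma aff_coordK : cancel aff_coord aff_of.
Proof.
move=> x; apply/val_inj; rewrite /= /aff_mx /aff_coord.
set t := vsval x _ _; have [x_tr xJ] := (mem_seaweed _).1 (subvsP x).
have ex : e^T *m vsval x = t *: e^T.
  rewrite -[LHS]mulmx1 -(corner_decomp K k) mulmxDr !mulmxA xJ mul0mx add0r.
  have -> : e^T *m vsval x *m e = t%:M.
    by rewrite last_mulmxl -colE [LHS]mx11_scalar !mxE.
  by rewrite mul_scalar_mx.
have -> : J *m (J^T *m (vsval x - t%:M)) = vsval x - t%:M.
  rewrite mulmxA -[X in X *m _](addrK (e *m e^T)) corner_decomp mulmxBl mul1mx.
  by rewrite -mulmxA mulmxBr ex mul_mx_scalar subrr mulmx0 subr0.
rewrite raddfB /= x_tr mxtrace_scalar sub0r -[t *+ n]mulr_natr mulNr mulfK ?pnatr_eq0 //.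
by rewrite raddfN /= opprK subrK.
Qed.

(** The scalar parts drop out of the commutator, and the commutator of J X and J Y is J (X J Y - Y J
    X). *)
Lemma aff_coord_lie (x y : g) :
  aff_coord (lie x y) = aff_coord x *m J *m aff_coord y - aff_coord y *m J *m aff_coord x.
Proof.
rewrite -{1}[x]aff_coordK -{1}[y]aff_coordK.
move: (aff_coord x) (aff_coord y) => X Y.
have xyE : vsval (lie (aff_of X) (aff_of Y)) = J *m (X *m J *m Y - Y *m J *m X).
  rewrite /= /aff_mx !mulmxBl !mulmxBr !mul_scalar_mx !mul_mx_scalar.
  rewrite !scale_scalar_mx [\tr (J *m Y) / _ * _]mulrC !mulmxA.
  move: (J *m X *m J *m Y) (J *m Y *m J *m X) (J *m X) (J *m Y) => P Q U V.
  by apply/matrixP => i j; rewrite !mxE; ring.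
rewrite /aff_coord xyE.
have -> : (J *m (X *m J *m Y - Y *m J *m X)) ord_max ord_max = 0.
  have /matrixP/(_ 0 ord_max) : e^T *m (J *m (X *m J *m Y - Y *m J *m X)) = 0.
    by rewrite mulmxA last_mul_corner mul0mx.
  by rewrite last_mulmxl mxE [RHS]mxE.
by rewrite raddf0 subr0 mulmxA corner_trmx_mul mul1mx.
Qed.

Lemma functional_coord (f : 'Hom(g, K^o)) :
  exists B : 'M[K]_(n, k), forall x, f x = \tr (B *m aff_coord x).
Proof.
exists (\matrix_(i, j) f (aff_of (delta_mx j i))) => x.
rewrite -{1}[x]aff_coordK; move: (aff_coord x) => X.
transitivity (\sum_i \sum_j X i j * f (aff_of (delta_mx i j))).
  rewrite {1}[X]matrix_sum_delta !linear_sum; apply: eq_bigr => i _.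
  by rewrite !linear_sum; apply: eq_bigr => j _; rewrite !linearZ.
rewrite exchange_big; apply: eq_bigr => i _; rewrite mxE.
by apply: eq_bigr => j _; rewrite mxE mulrC.
Qed.

(** The coadjoint action under the trace pairing: this matrix represents y |-> f [x, y] when B
    represents f and X represents x. *)
Definition coord_form (B : 'M[K]_(n, k)) (X : 'M[K]_(k, n)) : 'M[K]_(n, k) :=
  B *m (X *m J) - J *m (X *m B).

Lemma functional_lie (f : 'Hom(g, K^o)) B x y :
  (forall x, f x = \tr (B *m aff_coord x)) ->
  f (lie x y) = \tr (coord_form B (aff_coord x) *m aff_coord y).
Proof.
move=> fB; rewrite fB aff_coord_lie; move: (aff_coord x) (aff_coord y) => X Y.
rewrite mulmxBr mulmxBl !raddfB /= !mulmxA; congr (_ - _).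
by rewrite -[B *m _ *m J *m _]mulmxA mxtrace_mulC !mulmxA.
Qed.

Lemma coord_form_last B X : e^T *m coord_form B X = e^T *m B *m (X *m J).
Proof. by rewrite mulmxBr !mulmxA last_mul_corner !mul0mx subr0. Qed.

(** With A = X J, v = X e, M = J^T B and phi = e^T B, this block is M A - A M - v phi, while the
    last row is phi A. These are the quantities in the Krylov lemmas. *)
Lemma coord_form_corner B X :
  J^T *m coord_form B X =
  J^T *m B *m (X *m J) - X *m J *m (J^T *m B) - X *m e *m (e^T *m B).
Proof.
rewrite mulmxBr !mulmxA corner_trmx_mul mul1mx -addrA -opprD; congr (_ - _).
rewrite -!mulmxA -mulmxDr !mulmxA; congr (_ *m _).
by rewrite -mulmxDl corner_decomp mul1mx.
Qed.

(** * Frobenius functionals and their principal elements *)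

Definition corner_krylov (B : 'M[K]_(n, k)) := krylov K m (e^T *m B) (J^T *m B).

Lemma corner_inj (X Y : 'M[K]_(k, n)) : X *m J = Y *m J -> X *m e = Y *m e -> X = Y.
Proof.
move=> XJ Xe; rewrite -[X]mulmx1 -[Y]mulmx1 -(corner_decomp K k).
by rewrite !mulmxDr !mulmxA XJ Xe.
Qed.

Lemma frobenius_functional_krylov (f : 'Hom(g, K^o)) B :
  (forall x, f x = \tr (B *m aff_coord x)) ->
  frobenius_functional f <-> corner_krylov B \in unitmx.
Proof.
move=> fB; split=> [f_frob|C_unit].
  apply/idPn => /krylov_radical_neq0[A A_neq0 [phiA MA]].
  (* For N = A J^T one has N J = A and N e = 0, so the term v phi disappears and N lies in the
     radical. *)
  have X0 : aff_of (A *m J^T) = 0.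
    apply: f_frob => y; rewrite (functional_lie _ _ _ _ fB) aff_ofK.
    suff -> : coord_form B (A *m J^T) = 0 by rewrite mul0mx raddf0.
    have AJ : A *m J^T *m J = A by rewrite -mulmxA corner_trmx_mul mulmx1.
    apply: corner_last_inj; rewrite mulmx0 ?coord_form_last ?coord_form_corner !AJ //.
    by rewrite MA subrr sub0r -[A *m J^T *m e]mulmxA corner_mul_last mulmx0 mul0mx oppr0.
  case/eqP: A_neq0; rewrite -[A]mulmx1 -(corner_trmx_mul K k) mulmxA.
  by rewrite -[A *m J^T]aff_ofK X0 linear0 mul0mx.
move=> x x_rad.
have Y0 : coord_form B (aff_coord x) = 0.
  apply: mxtrace_mul_eq0 => X; rewrite -(aff_ofK X).
  by rewrite -(functional_lie _ _ _ _ fB) x_rad.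
have [||v0 A0] := krylov_radical0 _ _ _ _ (aff_coord x *m J) (aff_coord x *m e) C_unit.
- by rewrite -coord_form_last Y0 mulmx0.
- by apply/eqP; rewrite -subr_eq0 -coord_form_corner Y0 mulmx0.
rewrite -[x]aff_coordK; have -> : aff_coord x = 0.
  by apply: corner_inj; rewrite mul0mx.
by rewrite linear0.
Qed.

Lemma frobenius_aff : frobenius g.
Proof.
(* For the shift M and the first basis row phi, phi M^i is the basis row of index i, so the Krylov
   matrix is the identity. *)
pose M : 'M[K]_k := \matrix_(i, j) (j == i.+1 :> nat)%:R.
pose phi : 'rV[K]_k := delta_mx 0 ord0.
pose B := J *m M + e *m phi.
pose f : 'Hom(g, K^o) := linfun ((mxtrace : 'M[K]_n -> K^o) \o mulmx B \o aff_coord).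
exists f; apply/(frobenius_functional_krylov _ B); first by move=> x; rewrite lfunE.
rewrite /corner_krylov /B !mulmxDr !mulmxA last_mul_corner last_trmx_mul corner_trmx_mul.
rewrite corner_mul_last !mul1mx !mul0mx add0r addr0.
have phiM i : (i < k)%N -> phi *m M ^+ i = delta_mx 0 (inord i).
  elim: i => [|i IHi] ik.
    by rewrite mulmx1; congr delta_mx; apply/val_inj; rewrite /= inordK.
  rewrite exprSr mulmxA IHi 1?ltnW // -rowE; apply/rowP => j.
  by rewrite !mxE eqxx -val_eqE /= !inordK // ltnW.
rewrite (_ : krylov _ _ _ _ = 1%:M) ?unitmx1 //; apply/row_matrixP => i.
by rewrite row_krylov phiM // row1 inord_val.
Qed.

(** Being principal means that [coord_form] fixes B; its two blocks are the hypotheses of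
    [krylov_char_poly]. *)
Lemma aff_principal_char_poly (f : 'Hom(g, K^o)) (x : g) :
  frobenius_functional f -> principal_element f x ->
  char_poly (aff_coord x *m J) = \prod_(i < k) ('X - (i.+1%:R)%:P).
Proof.
have [B fB] := functional_coord f.
move=> /(frobenius_functional_krylov _ _ fB) C_unit fx.
have XB : coord_form B (aff_coord x) = B.
  apply/eqP; rewrite -subr_eq0; apply/eqP/mxtrace_mul_eq0 => Y.
  rewrite mulmxBl raddfB /= -[Y]aff_ofK -(functional_lie _ _ _ _ fB) -fB fx.
  exact: subrr.
apply: (krylov_char_poly _ _ _ _ _ (aff_coord x *m e) C_unit).
  by rewrite -coord_form_last XB.
by apply/eqP; rewrite -subr_eq -coord_form_corner XB.
Qed.

(* With [N = aff_coord x], [ad x] is the Sylvester operator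
   [X |-> (N *m J) *m X - X *m (J *m N)] on coordinates, and [J *m N] has the
   eigenvalues [d_i] of [N *m J] and [0], which [d *m J^T] lists. *)
Lemma char_poly_ad (x : g) (P : 'M[K]_k) (d : 'rV[K]_k) :
  P \in unitmx -> P *m (aff_coord x *m J) = diag_mx d *m P ->
  (forall i, d 0 i != 0) ->
  char_poly (mxof (vbasis {:g}) (vbasis {:g}) (ad x)) =
  \prod_(i < k) \prod_(j < n) ('X - (d 0 i - (d *m J^T) 0 j)%:P).
Proof.
have [N NE] : exists N, aff_coord x = N by exists (aff_coord x).
rewrite NE; set A := N *m J => P_unit PA d_neq0.
have A_unit : A \in unitmx.
  have : P *m A \in unitmx.
    rewrite PA unitmx_mul P_unit andbT unitmxE det_diag unitfE.
    by apply/prodf_neq0 => i _; apply: d_neq0.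
  by rewrite unitmx_mul P_unit.
have [d' d'E] : exists d', d' = d *m J^T by exists (d *m J^T).
have d'_widen j : d' 0 (widen_ord (leqnSn k) j) = d 0 j.
  by rewrite -corner_mulmxr d'E -mulmxA corner_trmx_mul mulmx1.
have d'_max : d' 0 ord_max = 0.
  have /matrixP/(_ 0 0) : d' *m e = 0 by rewrite d'E -mulmxA corner_mul_last mulmx0.
  by rewrite -colE !mxE.
rewrite -d'E.
have Jd : J *m diag_mx d = diag_mx d' *m J.
  apply/matrixP => i j; rewrite mul_mx_diag mul_diag_mx !mxE.
  by case: eqP => [->|_]; rewrite ?d'_widen ?mulr1 ?mul1r ?mul0r ?mulr0.
have d'e : diag_mx d' *m e = 0.
  apply/matrixP => i j; rewrite mul_diag_mx !mxE ord1.
  by case: (i =P ord_max) => [->|_]; rewrite ?d'_max ?mul0r ?mulr0.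
(* The rows of Q are left eigenvectors of J N: those of P N, since P N (J N) = P A N = diag(d) P N,
   followed by e^T, which J N kills. S is the inverse of Q. *)
pose Q := J *m P *m N + e *m e^T.
pose S := J *m invmx A *m invmx P *m J^T - J *m invmx A *m (N *m e) *m e^T + e *m e^T.
have QS : Q *m S = 1%:M.
  have eS : e^T *m S = e^T.
    rewrite mulmxDr mulmxBr !mulmxA last_mul_corner last_trmx_mul.
    by rewrite !mul0mx mul1mx subrr add0r.
  have NS : N *m S = invmx P *m J^T.
    rewrite mulmxDr mulmxBr !mulmxA -/A mulmxV // !mul1mx.
    by rewrite subrK.
  rewrite mulmxDl -!mulmxA eS NS [P *m _]mulmxA mulmxV // mul1mx.
  exact: corner_decomp.
have SQ := mulmx1C QS.
have QJN : Q *m (J *m N) = diag_mx d' *m Q.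
  rewrite mulmxDl mulmxDr !mulmxA d'e mul0mx addr0 -[e *m e^T *m J]mulmxA.
  rewrite last_mul_corner mulmx0 mul0mx addr0 -Jd.
  by rewrite -[J *m P *m N *m J]mulmxA -/A -[J *m P *m A]mulmxA PA !mulmxA.
have JNS : J *m N *m S = S *m diag_mx d'.
  have : S *m (Q *m (J *m N)) *m S = S *m (diag_mx d' *m Q) *m S by rewrite QJN.
  rewrite [S *m (Q *m _)]mulmxA SQ mul1mx [S *m (_ *m Q)]mulmxA.
  by rewrite -[_ *m Q *m S]mulmxA QS mulmx1.
(* In the coordinates P Y S the operator multiplies entry (i, j) by d_i - d'_j, so it is diagonal
   after flattening. *)
pose T : {linear g -> 'rV[K]_(k * n)} := mxvec \o mulmxr S \o mulmx P \o aff_coord.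
pose T' : {linear 'rV[K]_(k * n) -> g} :=
  aff_of \o mulmx (invmx P) \o mulmxr Q \o vec_mx.
pose c : 'M[K]_(k, n) := \matrix_(i, j) (d 0 i - d' 0 j).
rewrite (char_poly_mxof _ _ _ _ (diag_mx (mxvec c)) T T').
- rewrite char_poly_trig ?diag_mx_is_trig // pair_big /=.
  rewrite (reindex _ (curry_mxvec_bij k n)) /=; apply: eq_bigr => -[i j] _ /=.
  by rewrite mxE eqxx mulr1n mxvecE mxE.
- move=> y; rewrite /= mxvecK -[_ *m S *m Q]mulmxA SQ mulmx1 mulKmx //.
  exact: aff_coordK.
- move=> u; rewrite /= aff_ofK mulKVmx // -mulmxA QS mulmx1.
  exact: vec_mxK.
move=> y; rewrite /= adE aff_coord_lie NE; move: (aff_coord y) => Y.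
have -> : P *m (N *m J *m Y - Y *m J *m N) *m S =
    diag_mx d *m (P *m Y *m S) - P *m Y *m S *m diag_mx d'.
  rewrite mulmxBr mulmxBl !mulmxA -PA; congr (_ - _); rewrite /A ?mulmxA //.
  by rewrite -[_ *m J *m N]mulmxA -[_ *m (J *m N) *m S]mulmxA JNS !mulmxA.
move: (P *m Y *m S) => Z; rewrite mxvec_mul_diag; congr mxvec.
apply/matrixP => i j; rewrite mul_mx_diag mul_diag_mx !mxE.
by rewrite mulrBr [d 0 i * _]mulrC.
Qed.

Lemma spectrum_aff :
  is_spectrum g
    (\big[msetD/mset0]_(1 <= i < k.+1)
       (msetn i (- k%:R + i%:R : K) `+` msetn i (k%:R - i%:R + 1 : K))).
Proof.
split=> [|f f_frob]; first exact: frobenius_aff.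
have [x x_princ] := frobenius_principal _ _ _ f_frob.
exists x; split=> //.
pose s : seq K := [seq i.+1%:R | i : 'I_k <- enum 'I_k].
have s_uniq : uniq s.
  rewrite map_inj_uniq ?enum_uniq // => i j /eqP; rewrite eqr_nat eqSS => /eqP.
  exact: val_inj.
have A_char : char_poly (aff_coord x *m J) = \prod_(y <- s) ('X - y%:P).
  by rewrite (aff_principal_char_poly f x) ?big_map ?big_enum //; case: x_princ.
have [P P_unit [d PA ds]] := diagonalize_char_poly _ _ _ _ s_uniq A_char.
have d_neq0 i : d 0 i != 0.
  have : d 0 i \in s by rewrite -(perm_mem ds) map_f ?mem_enum.
  by case/mapP => j _ ->; rewrite pnatr_eq0.
apply/msetP => c; rewrite eigenvaluesE (char_poly_ad _ _ _ P_unit PA d_neq0).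
rewrite big_msetDE.
have -> : \prod_(i < k) \prod_(j < n) ('X - (d 0 i - (d *m J^T) 0 j)%:P) =
    \prod_(z <- [seq d 0 i - (d *m J^T) 0 j | i <- enum 'I_k, j <- enum 'I_n])
      ('X - z%:P).
  by rewrite big_allpairs_dep /= big_enum; apply: eq_bigr => i _; rewrite big_enum.
rewrite mu_prod_XsubC count_allpairs_ord.
have dJ i : (d *m J^T) 0 (widen_ord (leqnSn k) i) = d 0 i.
  by rewrite -corner_mulmxr -mulmxA corner_trmx_mul mulmx1.
have dJ_max : (d *m J^T) 0 ord_max = 0.
  have /matrixP/(_ 0 0) : d *m J^T *m e = 0 by rewrite -mulmxA corner_mul_last mulmx0.
  by rewrite -colE mxE [RHS]mxE.
(* G depends only on the multiset r, so the diagonal d may be replaced by 1, ..., k in order; the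
   term y - 0 accounts for the extra eigenvalue 0 of J N. *)
pose G (r : seq K) :=
  (\sum_(y <- r) (((y - 0)%R == c) + \sum_(z <- r) ((y - z)%R == c)))%N.
have G_perm r r' : perm_eq r r' -> G r = G r'.
  move=> rr'; rewrite /G (perm_big _ rr') /=; apply: eq_bigr => y _.
  by rewrite (perm_big _ rr').
transitivity (G [seq d 0 i | i <- enum 'I_k]).
  rewrite /G big_map big_enum; apply: eq_bigr => i _ /=.
  rewrite big_map big_enum big_ord_recr /= dJ_max addnC; congr addn.
  by apply: eq_bigr => j _; rewrite dJ.
rewrite (G_perm _ _ ds) /G big_map big_enum.
transitivity (\sum_(i < k) \sum_(j < n) ((1 *+ i.+1 - 1 *+ j : K)%R == c))%N.
  apply: eq_bigr => i _; rewrite big_ord_recl big_map big_enum /=; congr addn.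
rewrite spectrum_count big_add1 big_mkord (reindex_inj rev_ord_inj).
apply: eq_bigr => i _ /=; have ik := ltn_ord i.
rewrite msetE2 !msetn_mul mulnDr subKn //.
by rewrite [(k - i.+1).+1%:R]mulrSr !natrB // opprB [_ - k%:R]addrC.
Qed.

End Aff.

Theorem mainTheorem1 (R : realType) (k : nat) (hk : (1 <= k)%N) :
  let a := [:: k; 1%N] in
  let b := [:: k.+1] in
  let g : lieAlgType R[i] := seaweed R[i] k.+1 a b in
  [/\ frobenius g,
      is_spectrum g
        (\big[msetD/mset0]_(1 <= i < k.+1)
           (msetn i (- k%:R + i%:R : R[i]) `+` msetn i (k%:R - i%:R + 1 : R[i])))
    & is_extended_spectrum k.+1 a b
        (msetn k (0 : int) `+`
         \big[msetD/mset0]_(0 <= i < k)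
           (msetn i.+1 (- k%:Z + i%:Z) `+` msetn i.+1 (k%:Z - i%:Z)))].
Proof.
case: k hk => // m _ /=; split.
- exact: frobenius_aff.
- exact: spectrum_aff.
exact: meander_extended_spectrum.
Qed.
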